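(* Let $S\ge1$, $H\ge1$ be integers, let $T:\mathcal X^{n+m}\to\mathbb R$ be any test statistic, and let $p$ be the output of the density ratio permutation test with these inputs, initialized at $\sigma_0=\mathrm{id}_{n+m}$ (the identity permutation). If $H_0:g\propto rf$ is true, then $\mathbb P\{p\le\alpha\}\le\alpha$ for all $\alpha\in[0,1]$.
   Context: Setting. $\mathcal X$ is a sample space with dominating measure $\mu$; $f,g$ are probability densities with respect to $\mu$, and $r:\mathcal X\to(0,\infty)$ is a fixed measurable function. It is assumed that $f$ and $g$ have the same support, $\int g/r\,d\mu<\infty$ and $\int rf\,d\mu<\infty$. For $n,m\ge1$ one observes $Z=(Z_1,\ldots,Z_{n+m})=(X_1,\ldots,X_n,Y_1,\ldots,Y_m)$, with all variables independent, $X_i\sim f$, $Y_j\sim g$. $H_0:g\propto rf$ means $g=rf/\int rf\,d\mu$ ($\mu$-a.e.). $\mathcal S_{n+m}$ is the group of permutations of $[n+m]$ and $x_\sigma:=(x_{\sigma(1)},\ldots,x_{\sigma(n+m)})$. Pairwise sampler. Let $K=\min\{n,m\}$. Given $\sigma_{t-1}$ (and $Z$), the permutation $\sigma_t$ is obtained as follows: sample $(i_1^t,\ldots,i_K^t)$ uniformly without replacement from $[n]$ and (independently) $(j_1^t,\ldots,j_K^t)$ uniformly without replacement from $\{n+1,\ldots,n+m\}$; initialize $\sigma_t$ as a copy of $\sigma_{t-1}$; for each $k\in[K]$ draw independently a Bernoulli variable $B_k^t$ with $\mathbb P\{B_k^t=1\}=r(Z_{\sigma_{t-1}(i_k^t)})/\{r(Z_{\sigma_{t-1}(i_k^t)})+r(Z_{\sigma_{t-1}(j_k^t)})\}$,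 and swap the values $\sigma_t(i_k^t)$ and $\sigma_t(j_k^t)$ if $B_k^t=1$. Density ratio permutation test. Let $\sigma_*$ be the output of the pairwise sampler after $S$ steps started at $\sigma_0$. Conditionally on $\sigma_*$ (and $Z$), independently for each $h\in[H]$, let $\sigma^{(h)}$ be the output of the pairwise sampler after $S$ steps started at $\sigma_*$. Put $Z^{(h)}=Z_{\sigma^{(h)}}$ and return $p=(1+H)^{-1}\bigl(1+\sum_{h=1}^H\mathbb 1\{T(Z^{(h)})\ge T(Z)\}\bigr)$. *)

(* Defs.v *)
From HB Require Import structures.
From mathcomp Require Import all_boot all_order all_algebra all_fingroup.
From mathcomp Require Import all_classical all_reals all_analysis.

Set Implicit Arguments.
Unset Strict Implicit.
Unset Printing Implicit Defensive.
Import Order.TTheory GRing.Theory Num.Theory.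
Import numFieldNormedType.Exports.

Local Open Scope classical_set_scope.
Local Open Scope ring_scope.

Section Probability.
Context (R : realType) (dX dO : measure_display).
Context (X : measurableType dX) (Omega : measurableType dO).

Definition is_density (mu : {measure set X -> \bar R}) (f : X -> R) : Prop :=
  [/\ measurable_fun [set: X] f, forall x, 0 <= f x
    & (\int[mu]_x (f x)%:E)%E = 1%E].

Definition has_density (P : probability Omega R)
    (mu : {measure set X -> \bar R}) (V : Omega -> X) (f : X -> R) : Prop :=
  measurable_fun [set: Omega] V /\
  forall A : set X, measurable A ->
    P (V @^-1` A) = (\int[mu]_(x in A) (f x)%:E)%E.

(* Densities are only meaningful up to null sets, hence equality of supports
   (sets of non-zeros) is required almost everywhere. *)
Definition same_support (mu : {measure set X -> \bar R}) (f g : X -> R) :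
    Prop :=
  \forall x \ae mu, f x != 0 <-> g x != 0.

Definition mutually_independent (I : finType) (P : probability Omega R)
    (V : I -> Omega -> X) : Prop :=
  forall (J : {set I}) (A : I -> set X), (forall i, measurable (A i)) ->
    P [set w | forall i, i \in J -> A i (V i w)] =
    (\prod_(i in J) P (V i @^-1` A i))%E.

(* The F-valued variable W has conditional probability mass function q z
   given Z = z: P(Z \in A, W = u) = E[1_(Z \in A) q(Z, u)]. *)
Definition has_conditional_pmf (F : finType) (P : probability Omega R)
    (Z : Omega -> X) (W : Omega -> F) (q : X -> F -> R) : Prop :=
  (forall u, measurable (W @^-1` [set u])) /\
  forall (A : set X) (u : F), measurable A ->
    P (Z @^-1` A `&` W @^-1` [set u]) =
    (\int[P]_(w in Z @^-1` A) (q (Z w) u)%:E)%E.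

End Probability.

Section Permutations.
Context (X : Type) (k : nat).

(* x_s = (x_(s 0), ..., x_(s (k-1))) *)
Definition permuted (x : k.-tuple X) (s : 'S_k) : k.-tuple X :=
  [tuple tnth x (s i) | i < k].

End Permutations.

Section PairwiseSampler.
Context (R : realType) (X : Type) (r : X -> R) (n m : nat).

Let K := minn n m.

(* Ordered samples without replacement of size K from 'I_p. *)
Definition injections (p : nat) : {set {ffun 'I_K -> 'I_p}} :=
  [set i : {ffun 'I_K -> 'I_p} | injectiveb i].

(* The state s' reached from s when the drawn pairs are (i k, j k) and exactly
   the pairs with b k = true are swapped.  Positions of the first sample are
   embedded by lshift, those of the second one by rshift.  In MathComp
   (t * s)%g x = s (t x), so multiplying s by tperm x y on the left exchanges
   the values s x and s y.  For injective i and j the transpositions are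
   disjoint, so the order of the product is irrelevant. *)
Definition swap_pairs (s : 'S_(n + m)) (i : {ffun 'I_K -> 'I_n})
    (j : {ffun 'I_K -> 'I_m}) (b : {ffun 'I_K -> bool}) : 'S_(n + m) :=
  ((\prod_(k < K | b k) tperm (lshift m (i k)) (rshift n (j k))) * s)%g.

Definition swap_prob (z : (n + m).-tuple X) (s : 'S_(n + m))
    (a c : 'I_(n + m)) : R :=
  r (tnth z (s a)) / (r (tnth z (s a)) + r (tnth z (s c))).

Definition bernoulli_weight (p : R) (b : bool) : R := if b then p else 1 - p.

(* P(sigma_t = s' | sigma_(t-1) = s, Z = z): sum over all outcomes of the
   draws (i, j, b) that lead from s to s'. *)
Definition sampler_step (z : (n + m).-tuple X) (s s' : 'S_(n + m)) : R :=
  \sum_(i in injections n) \sum_(j in injections m)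
    \sum_(b : {ffun 'I_K -> bool} | swap_pairs s i j b == s')
      (#|injections n|%:R)^-1 * (#|injections m|%:R)^-1 *
      \prod_(k < K) bernoulli_weight
        (swap_prob z s (lshift m (i k)) (rshift n (j k))) (b k).

(* P(sigma_t = s' | sigma_0 = s, Z = z) for the Markov chain of the sampler. *)
Fixpoint sampler (t : nat) (z : (n + m).-tuple X) (s s' : 'S_(n + m)) : R :=
  if t is t'.+1 then
    \sum_(u : 'S_(n + m)) sampler t' z s u * sampler_step z u s'
  else (s == s')%:R.

(* Joint conditional mass function of (sigma_*, (sigma^(h))_h) given Z = z,
   for the initial permutation s0. *)
Definition drpt_law (S H : nat) (s0 : 'S_(n + m)) (z : (n + m).-tuple X)
    (u : 'S_(n + m) * {ffun 'I_H -> 'S_(n + m)}) : R :=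
  sampler S z s0 u.1 * \prod_(h < H) sampler S z u.1 (u.2 h).

Definition drpt_pvalue (H : nat) (T : (n + m).-tuple X -> R)
    (z : (n + m).-tuple X) (s : 'I_H -> 'S_(n + m)) : R :=
  (1 + H%:R)^-1 * (1 + \sum_(h < H) (T (permuted z (s h)) >= T z)%R%:R).

End PairwiseSampler.

Definition pooled (Omega X : Type) (n m : nat) (V : 'I_n -> Omega -> X)
    (W : 'I_m -> Omega -> X) (w : Omega) : (n + m).-tuple X :=
  [tuple of [tuple V i w | i < n] ++ [tuple W j w | j < m]].

(* Main.v *)
(** Write [rho z] for the product of [r] over the last [m] coordinates of [z].
    Under H0 the law of the pooled sample [Z] has density proportional to [rho]
    with respect to an exchangeable product measure, so that
    [E[Psi(Z) / rho(Z)] = E[Psi(Z_s) / rho(Z)]] for every permutation [s].  As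
    [mu] need not be sigma-finite, this is checked on boxes from independence
    alone, without forming product measures.

    For fixed [z] the sampler is reversible with respect to [s |-> rho(z_s)],
    because [r c * (r a / (r a + r c)) = r a * (r c / (r c + r a))] for each
    drawn pair.  Summing over the orbit of [z] and reversing the first [S]
    steps, the original data and the [H] copies become i.i.d. draws from the
    chain started at [sigma_*], hence exchangeable, while at most
    [alpha * (H + 1)] of [H + 1] scores can have rank at most
    [alpha * (H + 1)].  This bounds the rejection probability on each orbit,
    and the invariance above allows averaging over orbits. *)
Require Import Defs.
From HB Require Import structures.
From mathcomp Require Import all_boot all_order all_algebra all_fingroup.
From mathcomp Require Import all_classical all_reals all_analysis.
From mathcomp Require Import measurable_realfun ring.
Set Implicit Arguments.
Unset Strict Implicit.
Unset Printing Implicit Defensive.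
Import Order.TTheory GRing.Theory Num.Theory.
Import numFieldNormedType.Exports.
Local Open Scope classical_set_scope.
Local Open Scope ring_scope.

(** * Ranks of exchangeable scores *)

Lemma card_small_rank (R : realDomainType) (I : finType) (t : I -> R) (x : R) :
  0 <= x ->
  \sum_(l : I) ((\sum_(o : I) (t o >= t l)%R%:R <= x)%R)%:R <= x.
Proof.
move=> x0; pose A := [pred l : I | \sum_(o : I) (t o >= t l)%R%:R <= x].
have [l0 Al0|A0] := pickP A; last first.
  by rewrite big1 // => l _; have /= -> := A0 l.
(* The least score among those of small rank counts all of them in its rank. *)
have [l Al lmin] := arg_minP t Al0.
apply: le_trans (_ : \sum_(o : I) (t o >= t l)%R%:R <= x) => //.
apply: ler_sum => o _; rewrite ler_nat.
by case Ao: (_ <= x) => //; rewrite lmin.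
Qed.

(** Index [ord0] will carry the observed data, the lifted indices the [H] copies. *)
Lemma sum_ffun_ord_recl (R : nmodType) (G : finType) (H : nat)
    (F : {ffun 'I_H.+1 -> G} -> R) :
  \sum_w F w = \sum_(s : G) \sum_(v : {ffun 'I_H -> G})
    F [ffun o => if unlift ord0 o is Some h then v h else s].
Proof.
rewrite pair_big /=.
rewrite (reindex (fun p : G * {ffun 'I_H -> G} =>
  [ffun o => if unlift ord0 o is Some h then p.2 h else p.1])) //=.
exists (fun w : {ffun 'I_H.+1 -> G} => (w ord0, [ffun h => w (lift ord0 h)])).
  move=> [s v] _ /=; rewrite ffunE unlift_none; congr pair.
  by apply/ffunP => h; rewrite !ffunE liftK.
move=> w _; apply/ffunP => o; rewrite !ffunE.
by case: unliftP => [h|] -> //=; rewrite ffunE.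
Qed.

Section ExchangeableRank.
Variables (R : realFieldType) (G : finType) (H : nat).
Variables (q : G -> R) (t : G -> R) (alpha : R).
Hypotheses (q_ge0 : forall s, 0 <= q s) (q_le1 : \sum_s q s <= 1).
Hypothesis alpha_ge0 : 0 <= alpha.

Let rank (w : {ffun 'I_H.+1 -> G}) (l : 'I_H.+1) : R :=
  \sum_(o < H.+1) (t (w o) >= t (w l))%R%:R.

Let weight (w : {ffun 'I_H.+1 -> G}) : R := \prod_(o < H.+1) q (w o).

(** Exchanging the entries at [ord0] and [l] permutes the families [w], preserves their weight and
    exchanges the two ranks. *)
Let rank_sym (l : 'I_H.+1) :
  \sum_w weight w * (rank w l <= alpha * H.+1%:R)%R%:R =
  \sum_w weight w * (rank w ord0 <= alpha * H.+1%:R)%R%:R.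
Proof.
pose f (w : {ffun 'I_H.+1 -> G}) := [ffun o => w (tperm ord0 l o)].
have fK : involutive f by move=> w; apply/ffunP => o; rewrite !ffunE tpermK.
rewrite (reindex_inj (inv_inj fK)); apply: eq_bigr => w _.
congr (_ * _).
  rewrite /weight [RHS](reindex_inj (@perm_inj _ (tperm ord0 l))).
  by apply: eq_bigr => o _; rewrite ffunE.
congr (_ <= _)%R%:R.
rewrite /rank [RHS](reindex_inj (@perm_inj _ (tperm ord0 l))).
by apply: eq_bigr => o _; rewrite !ffunE tpermR.
Qed.

(** By symmetry the mass of a small rank at [ord0] is its average over all [H + 1] indices, and
    [card_small_rank] bounds the number of small ranks in each fixed family. *)
Lemma exchangeable_rank :
  \sum_(s : G) q s * (\sum_(v : {ffun 'I_H -> G}) \prod_(h < H) q (v h) *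
     ((1 + H%:R)^-1 * (1 + \sum_(h < H) (t (v h) >= t s)%R%:R) <= alpha)%R%:R)
  <= alpha.
Proof.
have -> : \sum_(s : G) q s *
    (\sum_(v : {ffun 'I_H -> G}) \prod_(h < H) q (v h) *
     ((1 + H%:R)^-1 * (1 + \sum_(h < H) (t (v h) >= t s)%R%:R) <= alpha)%R%:R)
   = \sum_w weight w * (rank w ord0 <= alpha * H.+1%:R)%R%:R.
  rewrite sum_ffun_ord_recl; apply: eq_bigr => s _.
  rewrite mulr_sumr; apply: eq_bigr => v _; rewrite mulrA; congr (_ * _).
    rewrite /weight big_ord_recl ffunE unlift_none; congr (_ * _).
    by apply: eq_bigr => h _; rewrite ffunE liftK.
  (* The leading [1] of the p-value is the comparison of [ord0] with itself. *)
  rewrite mulrC ler_pdivrMr ?ltr_wpDr// -(natrD _ 1 H) add1n.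
  congr (_ <= _)%R%:R.
  rewrite /rank big_ord_recl !ffunE unlift_none lexx; congr (_ + _).
  by apply: eq_bigr => h _; rewrite !ffunE liftK.
rewrite -(ler_pM2r (_ : 0 < H.+1%:R)) ?ltr0n//.
have -> : (\sum_w weight w * (rank w ord0 <= alpha * H.+1%:R)%R%:R) * H.+1%:R =
   \sum_w weight w * \sum_l ((rank w l <= alpha * H.+1%:R)%R%:R).
  transitivity (\sum_(l < H.+1)
      \sum_w weight w * (rank w l <= alpha * H.+1%:R)%R%:R).
    rewrite (eq_bigr _ (fun l _ => rank_sym l)).
    by rewrite sumr_const card_ord mulr_natr.
  by rewrite exchange_big; apply: eq_bigr => w _; rewrite mulr_sumr.
have aH : 0 <= alpha * H.+1%:R by rewrite mulr_ge0.
apply: (@le_trans _ _ (\sum_w weight w * (alpha * H.+1%:R))).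
  apply: ler_sum => w _; rewrite ler_wpM2l ?prodr_ge0//.
  exact: (card_small_rank (fun o => t (w o))).
(* The total weight factors into [H + 1] sums of [q], each at most 1. *)
rewrite -mulr_suml ler_piMl// /weight.
rewrite -(bigA_distr_bigA (fun (o : 'I_H.+1) (s : G) => q s)) /=.
by apply: prodr_ile1 => o _; rewrite sumr_ge0.
Qed.

End ExchangeableRank.

Lemma reversible_rank (R : realFieldType) (G : finType) (H : nat)
    (pi : G -> R) (k : G -> G -> R) (t : G -> R) (alpha : R) :
  (forall s, 0 <= pi s) -> (forall s u, 0 <= k s u) ->
  (forall s, \sum_u k s u <= 1) ->
  (forall s u, pi s * k s u = pi u * k u s) -> 0 <= alpha ->
  \sum_s pi s * (\sum_u k s u * (\sum_(v : {ffun 'I_H -> G})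
     \prod_(h < H) k u (v h) *
     ((1 + H%:R)^-1 * (1 + \sum_(h < H) (t (v h) >= t s)%R%:R) <= alpha)%R%:R))
  <= alpha * \sum_s pi s.
Proof.
move=> pi0 k0 k1 rev a0.
under eq_bigr do rewrite mulr_sumr.
rewrite exchange_big /= mulr_sumr; apply: ler_sum => u _.
(* By reversibility [s] becomes, like the [v h], a draw from [k u]. *)
under eq_bigr do rewrite mulrA rev -mulrA.
by rewrite -mulr_sumr [leRHS]mulrC ler_wpM2l// exchangeable_rank.
Qed.

(** * Permuted tuples and products of disjoint transpositions *)

Lemma permutedM (X : Type) (k : nat) (x : k.-tuple X) (s v : 'S_k) :
  permuted (permuted x s) v = permuted x (v * s)%g.
Proof. by apply: eq_from_tnth => i; rewrite !tnth_mktuple permM. Qed.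

Section DisjointTranspositions.
Variables (I T : finType) (a c : I -> T).
Hypotheses (a_inj : injective a) (c_inj : injective c).
Hypothesis ac : forall k l, a k != c l.

Let prodt (s : seq I) (b : pred I) : {perm T} :=
  (\prod_(k <- s | b k) tperm (a k) (c k))%g.

(** In a list without duplicates the transposition of index [k] occurs at most once, and by
    disjointness every other factor fixes [a k] and [c k]. *)
Let prodtE s (b : pred I) k : uniq s ->
  (prodt s b (a k) = if (k \in s) && b k then c k else a k) /\
  (prodt s b (c k) = if (k \in s) && b k then a k else c k).
Proof.
rewrite /prodt; elim: s => [|l s IH] /=; first by rewrite big_nil !perm1.
move=> /andP[ls us]; have [IHa IHc] := IH us.
rewrite big_cons inE; case: ifP => bl; last first.
  by rewrite IHa IHc; have [->|] := eqVneq k l; rewrite // (negbTE ls) bl.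
rewrite !permM; have [kl|kl] := eqVneq k l.
  by subst l; rewrite bl tpermL tpermR IHa IHc (negbTE ls).
have lk : l != k by rewrite eq_sym.
by rewrite !tpermD ?(inj_eq a_inj) ?(inj_eq c_inj) ?ac// eq_sym ac.
Qed.

Lemma prod_tpermL (b : pred I) k :
  (\prod_(l | b l) tperm (a l) (c l))%g (a k) = if b k then c k else a k.
Proof.
have [-> _] := prodtE b k (index_enum_uniq I).
by rewrite mem_index_enum.
Qed.

Lemma prod_tpermR (b : pred I) k :
  (\prod_(l | b l) tperm (a l) (c l))%g (c k) = if b k then a k else c k.
Proof.
have [_ ->] := prodtE b k (index_enum_uniq I).
by rewrite mem_index_enum.
Qed.

Lemma prod_tpermD (b : pred I) x :
  (forall k, a k != x) -> (forall k, c k != x) ->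
  (\prod_(l | b l) tperm (a l) (c l))%g x = x.
Proof.
move=> ax cx; elim/big_rec: _ => [|k s _ IH]; first by rewrite perm1.
by rewrite permM tpermD.
Qed.

Lemma prod_tperm_invol (b : pred I) :
  ((\prod_(l | b l) tperm (a l) (c l)) * (\prod_(l | b l) tperm (a l) (c l))
   = 1)%g.
Proof.
apply/permP => x; rewrite permM perm1.
have [k /eqP <-|ax] := pickP (fun k => a k == x).
  by rewrite prod_tpermL; case: ifP => bk; rewrite ?prod_tpermR ?prod_tpermL bk.
have [k /eqP <-|cx] := pickP (fun k => c k == x).
  by rewrite prod_tpermR; case: ifP => bk; rewrite ?prod_tpermR ?prod_tpermL bk.
by rewrite !prod_tpermD// => k; rewrite ?ax ?cx.
Qed.

End DisjointTranspositions.

(** * Reversibility of the sampler and the bound on one orbit *)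

Section SamplerReversible.
Variables (R : realType) (X : Type) (r : X -> R) (n m : nat).
Hypothesis r_gt0 : forall x, 0 < r x.
Let K := minn n m.
Implicit Types (z : (n + m).-tuple X) (s u : 'S_(n + m)).

(** This is [rho]: under the null hypothesis and up to a constant, the density of the pooled sample
    relative to drawing every coordinate from [f]. *)
Definition tail_prod z : R := \prod_(j < m) r (tnth z (rshift n j)).

Lemma tail_prod_gt0 z : 0 < tail_prod z.
Proof. by apply: prodr_gt0. Qed.

Lemma swap_prob_itv z s a c : 0 <= swap_prob r z s a c <= 1.
Proof.
have [ra rc] := (r_gt0 (tnth z (s a)), r_gt0 (tnth z (s c))).
apply/andP; split; first by rewrite divr_ge0 ?addr_ge0// ltW.
by rewrite ler_pdivrMr ?addr_gt0// mul1r lerDl ltW.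
Qed.

Lemma bernoulli_weight_ge0 (p : R) b : 0 <= p <= 1 -> 0 <= bernoulli_weight p b.
Proof. by move=> /andP[p0 p1]; case: b => //=; rewrite subr_ge0. Qed.

Lemma sampler_step_ge0 z s u : 0 <= sampler_step r z s u.
Proof.
rewrite /sampler_step; do 3 apply: sumr_ge0 => ? _.
rewrite !mulr_ge0// prodr_ge0// => k _.
by rewrite bernoulli_weight_ge0// swap_prob_itv.
Qed.

Lemma sampler_step_sum_le1 z s : \sum_u sampler_step r z s u <= 1.
Proof.
rewrite /sampler_step exchange_big /=.
under eq_bigr do rewrite exchange_big /=.
rewrite (eq_bigr (fun i => \sum_(j in injections n m m)
  #|injections n m n|%:R^-1 * #|injections n m m|%:R^-1)); last first.
  move=> i _; apply: eq_bigr => j _.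
  (* Each [b] leads to exactly one target, so summing over targets lifts the constraint on [b]; the
     weights then sum to a product of factors [p + (1 - p)]. *)
  under eq_bigr do rewrite big_mkcond /=.
  rewrite exchange_big /=.
  under eq_bigr => b _.
    rewrite -big_mkcond (big_pred1 (swap_pairs s i j b)); last first.
      by move=> u; rewrite /= eq_sym.
    over.
  rewrite -mulr_sumr -[RHS]mulr1; congr (_ * _).
  rewrite -(bigA_distr_bigA (fun k b => bernoulli_weight
     (swap_prob r z s (lshift m (i k)) (rshift n (j k))) b)) /=.
  by rewrite big1// => k _; rewrite big_bool /= addrC subrK.
rewrite !sumr_const -!mulrnA -[leLHS]mulr_natr natrM.
(* An inequality, because the inverse of 0 is 0; it spares counting the injections. *)
have inv1 (p : nat) : (p%:R : R)^-1 * p%:R <= 1.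
  case: p => [|p]; first by rewrite mulr0.
  by rewrite mulVf ?pnatr_eq0.
rewrite [leLHS](_ : _ = (#|injections n m n|%:R^-1 * #|injections n m n|%:R) *
  (#|injections n m m|%:R^-1 * #|injections n m m|%:R)); last by ring.
by rewrite mulr_ile1 ?mulr_ge0.
Qed.

(** Detailed balance for one fixed draw: the reverse move swaps the same pairs, so both sides carry
    the same [i], [j], [b], and the identity can be checked pair by pair. *)
Lemma swap_pairs_balance z s (i : {ffun 'I_K -> 'I_n}) (j : {ffun 'I_K -> 'I_m})
    (b : {ffun 'I_K -> bool}) : injective i -> injective j ->
  let w s := \prod_(k < K) bernoulli_weight
     (swap_prob r z s (lshift m (i k)) (rshift n (j k))) (b k) in
  tail_prod (permuted z s) * w s =
  tail_prod (permuted z (swap_pairs s i j b)) * w (swap_pairs s i j b).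
Proof.
move=> i_inj j_inj w; set s' := swap_pairs s i j b.
pose a k := lshift m (i k); pose c k := rshift n (j k).
have a_inj : injective a by move=> k l /lshift_inj/i_inj.
have c_inj : injective c by move=> k l /rshift_inj/j_inj.
have ac k l : a k != c l by rewrite eq_lrshift.
have s'a k : s' (a k) = if b k then s (c k) else s (a k).
  by rewrite /s' /swap_pairs permM prod_tpermL//; case: ifP.
have s'c k : s' (c k) = if b k then s (a k) else s (c k).
  by rewrite /s' /swap_pairs permM prod_tpermR//; case: ifP.
(* The second-sample positions split into those drawn by [j] and those that the move leaves
   alone. *)
have tailE v : tail_prod (permuted z v) =
    (\prod_k r (tnth z (v (c k)))) *
    \prod_(l < m | l \notin j @: 'I_K) r (tnth z (v (rshift n l))).
  rewrite /tail_prod (bigID (fun l => l \in j @: 'I_K)) /=; congr (_ * _).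
    rewrite big_imset /=; last by move=> ? ? _ _ /j_inj.
    by apply: eq_big => [k|k _]; rewrite ?inE ?tnth_mktuple.
  by apply: eq_bigr => l _; rewrite tnth_mktuple.
rewrite !tailE mulrAC [RHS]mulrAC; congr (_ * _); last first.
  apply: eq_bigr => l lj; rewrite /s' /swap_pairs permM prod_tpermD//.
    by move=> k; rewrite eq_lrshift.
  move=> k; apply: contra lj; rewrite eq_rshift => /eqP <-.
  by rewrite imset_f.
rewrite -!big_split; apply: eq_bigr => k _ /=.
rewrite /swap_prob -/(a k) -/(c k) s'a s'c; case: (b k) => //=.
by rewrite mulrCA [_ + r (tnth z (s (a k)))]addrC.
Qed.

(** A swap is its own inverse, so the draws leading from [s] to [u] are exactly those leading back,
    and they balance one by one. *)
Lemma sampler_step_reversible z s u :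
  tail_prod (permuted z s) * sampler_step r z s u =
  tail_prod (permuted z u) * sampler_step r z u s.
Proof.
rewrite /sampler_step !mulr_sumr.
apply: eq_bigr => i; rewrite inE => /injectiveP i_inj.
rewrite !mulr_sumr; apply: eq_bigr => j; rewrite inE => /injectiveP j_inj.
rewrite !mulr_sumr.
have swapK b : involutive (fun s => swap_pairs s i j b).
  move=> v; rewrite /swap_pairs mulgA prod_tperm_invol ?mul1g//.
  - by move=> k l /lshift_inj/i_inj.
  - by move=> k l /rshift_inj/j_inj.
  - by move=> k l; rewrite eq_lrshift.
apply: eq_big => [b|b /eqP <-].
  by apply/eqP/eqP => <-; rewrite swapK.
by rewrite mulrCA (swap_pairs_balance z s b i_inj j_inj) mulrCA.
Qed.

(** Swaps multiply the state on the left and the weights see only the values [tnth z (s a)], so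
    permuting the data amounts to a right translation of the states. *)
Lemma sampler_step_permuted z v s u :
  sampler_step r (permuted z v) s u = sampler_step r z (s * v)%g (u * v)%g.
Proof.
apply: eq_bigr => i _; apply: eq_bigr => j _; apply: eq_big => [b|b _].
  by rewrite /swap_pairs mulgA (inj_eq (mulIg v)).
congr (_ * _); apply: eq_bigr => k _.
by rewrite /swap_prob !tnth_mktuple !permM.
Qed.

Lemma sampler_ge0 t z s u : 0 <= sampler r t z s u.
Proof.
elim: t u => [|t IH] u /=; first by [].
by apply: sumr_ge0 => v _; rewrite mulr_ge0// sampler_step_ge0.
Qed.

Lemma sampler_sum_le1 t z s : \sum_u sampler r t z s u <= 1.
Proof.
elim: t => [|t IH] /=.
  by rewrite (bigD1 s)//= eqxx big1 ?addr0// => u /negbTE; rewrite eq_sym => ->.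
rewrite exchange_big /=; apply: le_trans IH; apply: ler_sum => v _.
by rewrite -mulr_sumr ler_piMr ?sampler_ge0// sampler_step_sum_le1.
Qed.

Lemma sampler_permuted t z v s u :
  sampler r t (permuted z v) s u = sampler r t z (s * v)%g (u * v)%g.
Proof.
elim: t u => [|t IH] u /=; first by rewrite (inj_eq (mulIg v)).
rewrite [RHS](reindex_inj (mulIg v)); apply: eq_bigr => w _.
by rewrite IH sampler_step_permuted.
Qed.

(** [sampler] unfolds at its last step; reversing a path also requires peeling off the first one. *)
Lemma samplerSr t z s u :
  sampler r t.+1 z s u = \sum_v sampler_step r z s v * sampler r t z v u.
Proof.
elim: t u => [|t IH] u.
  rewrite /= (bigD1 s)//= eqxx mul1r big1 => [|v /negbTE]; last first.
    by rewrite eq_sym => ->; rewrite mul0r.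
  rewrite [RHS](bigD1 u)//= eqxx mulr1 big1 => [|v /negbTE ->]; last first.
    by rewrite mulr0.
  by [].
rewrite [LHS]/=; under eq_bigr do rewrite -/(sampler r t.+1 z s _) IH mulr_suml.
rewrite exchange_big; apply: eq_bigr => v _ /=.
by rewrite mulr_sumr; apply: eq_bigr => w _; rewrite mulrA.
Qed.

Lemma sampler_reversible t z s u :
  tail_prod (permuted z s) * sampler r t z s u =
  tail_prod (permuted z u) * sampler r t z u s.
Proof.
elim: t s u => [|t IH] s u.
  by rewrite /= eq_sym; case: eqP => [->|]; rewrite ?mulr0.
rewrite samplerSr [sampler r t.+1 z u s]/= !mulr_sumr.
apply: eq_bigr => v _.
by rewrite mulrA sampler_step_reversible mulrAC IH mulrA.
Qed.

(** On the data [permuted z s], the chain from the identity is, after right translation by [s], the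
    chain from [s] on [z]. All terms thus share the kernel [sampler r S z], and [reversible_rank]
    applies. *)
Lemma drpt_orbit_bound (S H : nat) (T : (n + m).-tuple X -> R) z alpha :
  0 <= alpha ->
  \sum_s tail_prod (permuted z s) * (\sum_u drpt_law r S 1%g (permuted z s) u *
     (drpt_pvalue (H := H) T (permuted z s) u.2 <= alpha)%R%:R)
  <= alpha * \sum_s tail_prod (permuted z s).
Proof.
move=> a0.
pose k := sampler r S z; pose t s := T (permuted z s).
have := @reversible_rank R _ H (fun s => tail_prod (permuted z s)) k t alpha
  (fun s => ltW (tail_prod_gt0 _)) (fun s u => sampler_ge0 _ _ _ _)
  (sampler_sum_le1 S z) (sampler_reversible S z) a0.
apply: le_trans; rewrite le_eqVlt; apply/orP; left; apply/eqP.
apply: eq_bigr => s _; congr (_ * _).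
rewrite -(pair_bigA _ (fun u (v : {ffun 'I_H -> 'S_(n + m)}) =>
  drpt_law r S 1%g (permuted z s) (u, v) *
  (drpt_pvalue (H := H) T (permuted z s) v <= alpha)%R%:R)) /=.
rewrite [RHS](reindex_inj (mulIg s)); apply: eq_bigr => u _.
rewrite mulr_sumr.
pose shift (v : {ffun 'I_H -> 'S_(n + m)}) := [ffun h => (v h * s)%g].
have shift_inj : injective shift.
  move=> v w /ffunP vw; apply/ffunP => h.
  by have := vw h; rewrite !ffunE => /mulIg.
rewrite [RHS](reindex_inj shift_inj); apply: eq_bigr => v _.
rewrite /drpt_law /= sampler_permuted mul1g -mulrA; congr (_ * (_ * _)).
  by apply: eq_bigr => h _; rewrite sampler_permuted ffunE.
rewrite /drpt_pvalue; congr (_ * (_ + _) <= _)%R%:R.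
by apply: eq_bigr => h _; rewrite permutedM ffunE.
Qed.

End SamplerReversible.

(** * Weighted measures and comparison of their images *)

Section DensityMeasure.
Local Open Scope ereal_scope.
Context d (T : measurableType d) (R : realType).
Variables (mu : {measure set T -> \bar R}) (w : T -> R).

(* The two proofs only serve to let canonical structures find the measure. *)
Definition density_measure (mw : measurable_fun [set: T] w)
    (w_ge0 : forall x, (0 <= w x)%R) (A : set T) : \bar R :=
  \int[mu]_(x in A) (w x)%:E.

Hypotheses (mw : measurable_fun [set: T] w) (w_ge0 : forall x, (0 <= w x)%R).

Local Notation nu := (density_measure mw w_ge0).

Let nu0 : nu set0 = 0.
Proof. exact: integral_set0. Qed.

Let nu_ge0 A : 0 <= nu A.
Proof. by apply: integral_ge0 => x _; rewrite lee_fin. Qed.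

Let nu_sigma_additive : semi_sigma_additive nu.
Proof.
apply: semi_sigma_additive_nng_induced => [|x]; last by rewrite lee_fin.
exact/measurable_EFinP.
Qed.

HB.instance Definition _ := isMeasure.Build _ _ _ nu
  nu0 nu_ge0 nu_sigma_additive.

Import HBNNSimple.

(** A simple function is a finite combination of indicators of its level sets, and for an indicator
    the formula is the definition of [nu]. *)
Let nnsfun_density (h : {nnsfun T >-> R}) :
  \int[nu]_x (h x)%:E = \int[mu]_x ((h x)%:E * (w x)%:E).
Proof.
have mwE : measurable_fun [set: T] (fun x => (w x)%:E).
  exact/measurable_EFinP.
have mh y : measurable (h @^-1` [set y]) by exact: measurable_sfunP.
have mi y : measurable_fun [set: T] (fun x => (\1_(h @^-1` [set y]) x : R)%:E).
  exact/measurable_EFinP.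
pose f : T -> R := h.
have hE x : (f x)%:E = \sum_(y \in range f) y%:E * (\1_(f @^-1` [set y]) x)%:E.
  by rewrite /f fimfunE -fsumEFin.
have yi_ge0 y x : 0 <= y%:E * (\1_(f @^-1` [set y]) x)%:E.
  exact: nnfun_muleindic_ge0.
rewrite -/f.
under [LHS]eq_integral do rewrite hE.
rewrite [RHS](_ : _ = \int[mu]_x (\sum_(y \in range f)
    (y%:E * (\1_(f @^-1` [set y]) x)%:E * (w x)%:E))); last first.
  by apply: eq_integral => x _; rewrite hE ge0_mule_fsuml.
rewrite !ge0_integral_fsum//; first last.
- by move=> y; apply: measurable_funeM.
- by move=> y x _; rewrite mule_ge0// lee_fin.
- by move=> y; apply: emeasurable_funM => //; apply: measurable_funeM.
apply: eq_fsbigr => y; rewrite inE => -[x _ <-].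
rewrite ge0_integralZl//; last by rewrite lee_fin.
under [RHS]eq_integral do rewrite -muleA.
rewrite ge0_integralZl//; first last.
- by rewrite lee_fin.
- by move=> z _; rewrite mule_ge0// lee_fin.
- exact: emeasurable_funM.
congr (_ * _); rewrite integral_indic// setIT.
rewrite [LHS]integral_mkcond; apply: eq_integral => z _.
by rewrite epatch_indic muleC.
Qed.

Lemma ge0_integral_density (h : T -> R) :
  measurable_fun [set: T] h -> (forall x, (0 <= h x)%R) ->
  \int[nu]_x (h x)%:E = \int[mu]_x (h x * w x)%:E.
Proof.
move=> /measurable_EFinP mh h0; pose s := nnsfun_approx measurableT mh.
have sh x : (s n x)%:E @[n --> \oo] --> (h x)%:E.
  by apply: cvg_nnsfun_approx => // y _; rewrite lee_fin.
have nds x : {homo (fun n => s n x) : a b / (a <= b)%N >-> (a <= b)%R}.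
  by move=> a b ab; exact/lefP/nd_nnsfun_approx.
have ms n : measurable_fun [set: T] (fun x => (s n x)%:E).
  exact/measurable_EFinP.
(* Monotone convergence on both sides extends the formula from simple functions, for an arbitrary
   measure [mu]. *)
transitivity (limn (fun n => \int[nu]_x (s n x)%:E)).
  rewrite -monotone_convergence//.
  - by apply: eq_integral => x _; apply/esym/cvg_lim.
  - by move=> n x _; rewrite lee_fin.
  - by move=> x _ a b ab; rewrite lee_fin nds.
under eq_fun do rewrite nnsfun_density.
rewrite -monotone_convergence//.
- apply: eq_integral => x _; apply/cvg_lim => //.
  by rewrite EFinM; apply: cvgeZr.
- by move=> n; apply: emeasurable_funM => //; exact/measurable_EFinP.
- by move=> n x _; rewrite mule_ge0 ?lee_fin.
- by move=> x _ a b ab; rewrite lee_wpmul2r// lee_fin// nds.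
Qed.

End DensityMeasure.

Section Transport.
Local Open Scope ereal_scope.
Context (d1 d2 d : measure_display) (R : realType).
Context (T1 : measurableType d1) (T2 : measurableType d2).
Context (Y : measurableType d).
Variables (m1 : {measure set T1 -> \bar R}) (m2 : {measure set T2 -> \bar R}).
Variables (V1 : T1 -> Y) (V2 : T2 -> Y) (w1 : T1 -> R) (w2 : T2 -> R).
Hypotheses (mV1 : measurable_fun [set: T1] V1).
Hypotheses (mV2 : measurable_fun [set: T2] V2).
Hypotheses (mw1 : measurable_fun [set: T1] w1).
Hypotheses (mw2 : measurable_fun [set: T2] w2).
Hypotheses (w1_ge0 : forall x, (0 <= w1 x)%R).
Hypotheses (w2_ge0 : forall x, (0 <= w2 x)%R).

(** Both sides integrate [h] against the image of a weighted measure, and the hypothesis says that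
    the two images coincide. *)
Lemma integral_transport (h : Y -> R) :
  (forall B, measurable B ->
    \int[m1]_(x in V1 @^-1` B) (w1 x)%:E =
    \int[m2]_(x in V2 @^-1` B) (w2 x)%:E) ->
  measurable_fun [set: Y] h -> (forall y, (0 <= h y)%R) ->
  \int[m1]_x (h (V1 x) * w1 x)%:E = \int[m2]_x (h (V2 x) * w2 x)%:E.
Proof.
move=> V12 mh h0.
have h0E : {in [set: Y], forall y, 0 <= (h y)%:E}.
  by move=> y _; rewrite lee_fin.
have mhE : measurable_fun [set: Y] (fun y => (h y)%:E).
  exact/measurable_EFinP.
have mhV1 : measurable_fun [set: T1] (h \o V1) by exact: measurableT_comp.
have mhV2 : measurable_fun [set: T2] (h \o V2) by exact: measurableT_comp.
rewrite -(ge0_integral_density m1 mw1 w1_ge0 mhV1 (fun x => h0 (V1 x))).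
rewrite -(ge0_integral_density m2 mw2 w2_ge0 mhV2 (fun x => h0 (V2 x))).
have := ge0_integral_pushforward mV1 (density_measure m1 mw1 w1_ge0)
  measurableT mhE h0E.
have := ge0_integral_pushforward mV2 (density_measure m2 mw2 w2_ge0)
  measurableT mhE h0E.
rewrite !preimage_setT => <- <-.
by apply: eq_measure_integral => B mB _; exact: V12.
Qed.

End Transport.

(** Boxes are the generators on which independence gives information. *)
Lemma measurable_tuple_rectangles d (X : measurableType d) n :
  @measurable _ (n.-tuple X) =
  <<s [set [set t : n.-tuple X | forall i, A i (tnth t i)]
       | A in [set A : 'I_n -> set X | forall i, measurable (A i)]] >>.
Proof.
apply/seteqP; split.
  apply: smallest_sub; first exact: smallest_sigma_algebra.
  elim/big_ind : _ => [//|U V HU HV|i _ _ [B mB <-]].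
    by move=> W [/HU|/HV].
  (* A cylinder over coordinate [i] is the box whose other sides are [setT]. *)
  apply: sub_sigma_algebra; exists (fun j => if j == i then B else setT).
    by move=> j; case: ifP.
  apply/seteqP; split => t /=.
    by move=> /(_ i); rewrite eqxx.
  by move=> [_ Bt] j; case: eqP => // ->.
apply: smallest_sub; first exact: sigma_algebra_measurable.
move=> _ [A mA <-].
rewrite (_ : [set _ | _] =
    \bigcap_(i in [set: 'I_n]) ((@tnth n X)^~ i @^-1` A i)).
  apply: fin_bigcap_measurable => // i _.
  by rewrite -[X in measurable X]setTI; exact: measurable_tnth.
by apply/seteqP; split => t /= h i; [move=> _; exact: h|exact: h].
Qed.

Section TupleTransport.
Local Open Scope ereal_scope.
Context (d1 d2 d : measure_display) (R : realType).
Context (T1 : measurableType d1) (T2 : measurableType d2).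
Context (X : measurableType d) (n : nat).
Variables (m1 : {measure set T1 -> \bar R}) (m2 : {measure set T2 -> \bar R}).
Variables (V1 : T1 -> n.-tuple X) (V2 : T2 -> n.-tuple X).
Variables (w1 : T1 -> R) (w2 : T2 -> R).
Hypotheses (mV1 : measurable_fun [set: T1] V1).
Hypotheses (mV2 : measurable_fun [set: T2] V2).
Hypotheses (mw1 : measurable_fun [set: T1] w1).
Hypotheses (mw2 : measurable_fun [set: T2] w2).
Hypotheses (w1_ge0 : forall x, (0 <= w1 x)%R).
Hypotheses (w2_ge0 : forall x, (0 <= w2 x)%R).

(** Boxes are stable under intersection and generate the sigma-algebra, so two measures of finite
    total mass that agree on boxes are equal. *)
Lemma tuple_integral_transport (h : n.-tuple X -> R) :
  (forall A : 'I_n -> set X, (forall i, measurable (A i)) ->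
    \int[m1]_(x in [set x | forall i, A i (tnth (V1 x) i)]) (w1 x)%:E =
    \int[m2]_(x in [set x | forall i, A i (tnth (V2 x) i)]) (w2 x)%:E) ->
  \int[m1]_x (w1 x)%:E < +oo ->
  measurable_fun [set: n.-tuple X] h -> (forall y, (0 <= h y)%R) ->
  \int[m1]_x (h (V1 x) * w1 x)%:E = \int[m2]_x (h (V2 x) * w2 x)%:E.
Proof.
move=> V12 fin1 mh h0; apply: integral_transport => // B mB.
pose nu1 : {measure set (n.-tuple X) -> \bar R} :=
  pushforward (density_measure m1 mw1 w1_ge0) V1.
pose nu2 : {measure set (n.-tuple X) -> \bar R} :=
  pushforward (density_measure m2 mw2 w2_ge0) V2.
change (nu1 mV1 B = nu2 mV2 B).
(* The total mass being finite, the constant sequence [setT] serves as the exhaustion. *)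
apply: (@measure_unique _ _ _ _ (fun=> setT) (measurable_tuple_rectangles X n)
  _ _ _ (nu1 mV1) (nu2 mV2)) => //.
- move=> _ _ [A mA <-] [A' mA' <-].
  exists (fun i => A i `&` A' i); first by move=> i; exact: measurableI.
  apply/seteqP; split => t /=.
    by move=> tAA; split => i; have [] := tAA i.
  by move=> [tA tA'] i.
- move=> _; exists (fun=> setT) => //.
  by apply/seteqP; split.
- by apply/seteqP; split => // t _; exists 0%N.
- by move=> _ [A mA <-]; exact: V12.
Qed.

End TupleTransport.

(** * Expectation of a product of functions of independent variables *)

Section IndependentExpectation.
Local Open Scope ereal_scope.
Context (d dO : measure_display) (R : realType).
Context (X : measurableType d) (Omega : measurableType dO) (I : finType).
Variables (P : probability Omega R) (V : I -> Omega -> X).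
Hypothesis mV : forall i, measurable_fun [set: Omega] (V i).
Hypothesis indepV : mutually_independent P V.

Let good (h : I -> X -> R) := forall i,
  [/\ measurable_fun [set: X] (h i), (forall x, (0 <= h i x)%R) &
      \int[P]_w (h i (V i w))%:E < +oo].

(* Indicators are replaced by the functions [h i] one index at a time. *)
Let expectation_prod_partial (s : seq I) (h : I -> X -> R) : good h ->
  (forall i, i \notin s -> exists2 A, measurable A & h i = \1_A) ->
  \int[P]_w (\prod_i h i (V i w))%:E = \prod_i \int[P]_w (h i (V i w))%:E.
Proof.
elim: s h => [|i s IH] h gh hs.
  (* With only indicators left, the claim is independence for the full index set. *)
  have {}hs i : {A | measurable A & h i = \1_A} by apply: cid2; exact: hs.
  pose A i := s2val (hs i).
  have mA i : measurable (A i) by exact: (s2valP (hs i)).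
  have hA i : h i = \1_(A i) by exact: (s2valP' (hs i)).
  have mVA i : measurable (V i @^-1` A i).
    by rewrite -[X in measurable X]setTI; exact: mV.
  transitivity (P [set w | forall i, i \in [set: I]%SET -> A i (V i w)]).
    rewrite -[X in P X]setIT -integral_indic//; last first.
      rewrite (_ : [set w | _] = \bigcap_(i in [set: I]) (V i @^-1` A i)).
        by apply: fin_bigcap_measurable.
      by apply/seteqP; split => w /= Aw i _; apply: Aw; rewrite ?inE.
    apply: eq_integral => w _; congr _%:E; rewrite indicE.
    have [/= Aw|/= Aw] := pselect (forall i, i \in [set: I]%SET -> A i (V i w)).
      rewrite mem_set// big1// => i _.
      by rewrite hA indicE mem_set//; apply: Aw; rewrite inE.
    rewrite memNset//.
    have /existsNP[i /not_implyP[_ Ai]] := Aw.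
    by rewrite (bigD1 i)//= hA indicE memNset ?mul0r.
  rewrite indepV//; apply: eq_big => [i|i _]; first by rewrite inE.
  by rewrite hA -[V i @^-1` A i]setIT -integral_indic.
pose g (B : set X) j := if j == i then \1_B else h j.
have gB B : measurable B -> good (g B).
  move=> mB j; rewrite /g; case: eqP => [->|_]; last exact: gh.
  split; first exact: measurable_indic.
    by move=> x; rewrite indicE.
  have mVB : measurable (V i @^-1` B).
    by rewrite -[X in measurable X]setTI; exact: mV.
  rewrite (_ : (fun w => _) = (fun w => (\1_(V i @^-1` B) w)%:E))//.
  by rewrite integral_indic// setIT (le_lt_trans (probability_le1 _ _))// ltry.
(* The weight [w1] is to be replaced by the constant [c]. Their images under [V i] agree on a set
   [B] by the induction hypothesis for [g B], where [h i] has become the indicator of [B]. *)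
pose w1 w := (\prod_(j | j != i) h j (V j w))%R.
pose c := \prod_(j | j != i) \int[P]_w (h j (V j w))%:E.
have c_ge0 : 0 <= c.
  apply: prode_ge0 => j _; apply: integral_ge0 => w _; rewrite lee_fin.
  by have [] := gh j.
have c_fin : c \is a fin_num.
  apply: prode_fin_num => j _; have [_ h0 ?] := gh j.
  by rewrite ge0_fin_numE// integral_ge0// => w _; rewrite lee_fin.
have mw1 : measurable_fun [set: Omega] w1.
  rewrite /w1; under eq_fun do rewrite -big_filter.
  apply: measurable_prod => j _; have [mhj _ _] := gh j.
  exact: measurableT_comp.
have w1_ge0 w : (0 <= w1 w)%R.
  by apply: prodr_ge0 => j _; have [] := gh j.
have [mhi hi_ge0 _] := gh i.
transitivity (\int[P]_w (h i (V i w) * w1 w)%:E).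
  by apply: eq_integral => w _; rewrite (bigD1 i).
rewrite (integral_transport (mV i) (mV i) mw1 (w2 := cst (fine c)) (m2 := P))//.
- under eq_integral do rewrite EFinM muleC fineK//.
  rewrite ge0_integralZl//.
  + by rewrite [RHS](bigD1 i)//= muleC.
  + by apply/measurable_EFinP; exact: measurableT_comp.
  + by move=> w _; rewrite lee_fin.
- by move=> w; rewrite fine_ge0.
move=> B mB.
have mVB : measurable (V i @^-1` B).
  by rewrite -[X in measurable X]setTI; exact: mV.
under [RHS]eq_integral do rewrite /cst fineK//.
rewrite integral_cst// integral_mkcond.
transitivity (\int[P]_w (\prod_j g B j (V j w))%:E).
  apply: eq_integral => w _; rewrite epatch_indic -EFinM (bigD1 i)//= mulrC.
  congr (_ * _)%:E; first by rewrite /g eqxx.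
  by apply: eq_bigr => j /negbTE ji; rewrite /g ji.
rewrite IH.
- rewrite (bigD1 i)//= muleC; congr (_ * _).
    by apply: eq_bigr => j /negbTE ji; rewrite /g ji.
  rewrite /g eqxx -[X in _ = P X]setIT -integral_indic//.
- exact: gB.
- move=> j js; rewrite /g; case: (boolP (j == i)) => ji; first by exists B.
  by apply: hs; rewrite inE negb_or ji.
Qed.

Lemma expectation_prod (h : I -> X -> R) :
  (forall i, measurable_fun [set: X] (h i)) -> (forall i x, (0 <= h i x)%R) ->
  (forall i, \int[P]_w (h i (V i w))%:E < +oo) ->
  \int[P]_w (\prod_i h i (V i w))%:E = \prod_i \int[P]_w (h i (V i w))%:E.
Proof.
move=> mh h0 hfin; apply: (expectation_prod_partial (s := enum I)) => [i|i].
  by split.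
by rewrite mem_enum.
Qed.

End IndependentExpectation.

(** * Measurability of the sampler and of the p-value *)

Section MeasurableTuple.
Context (d : measure_display) (X : measurableType d) (R : realType).

Lemma measurable_permuted k (s : 'S_k) :
  measurable_fun [set: k.-tuple X] (fun x => permuted x s).
Proof.
apply/measurable_fun_tnthP => i.
rewrite (_ : _ \o _ = (@tnth k X)^~ (s i)); first exact: measurable_tnth.
by apply/funext => x /=; rewrite tnth_mktuple.
Qed.

Lemma measurable_pooled (dO : measure_display) (Omega : measurableType dO)
    n m (V : 'I_n -> Omega -> X) (W : 'I_m -> Omega -> X) :
  (forall i, measurable_fun [set: Omega] (V i)) ->
  (forall j, measurable_fun [set: Omega] (W j)) ->
  measurable_fun [set: Omega] (pooled V W).
Proof.
move=> mV mW; apply/measurable_fun_tnthP => l.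
rewrite -(splitK l); case: (fintype.split l) => [i|j] /=.
  rewrite (_ : _ \o _ = V i)//; apply/funext => w /=.
  by rewrite tnth_lshift tnth_mktuple.
rewrite (_ : _ \o _ = W j)//; apply/funext => w /=.
by rewrite tnth_rshift tnth_mktuple.
Qed.

Variable r : X -> R.
Hypotheses (r_meas : measurable_fun [set: X] r) (r_gt0 : forall x, 0 < r x).

Lemma measurable_funV_gt0 (d' : measure_display) (T : measurableType d')
    (f : T -> R) :
  measurable_fun [set: T] f -> (forall x, 0 < f x) ->
  measurable_fun [set: T] (fun x => (f x)^-1).
Proof.
move=> mf f0.
(* On positive reals the inverse is the power of exponent -1. *)
rewrite (_ : (fun x => _) = fun x => f x `^ (-1)).
  exact: (measurableT_comp (measurable_powR _)).
by apply/funext => x; rewrite powR_inv1// ltW.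
Qed.

Lemma measurable_natr_bool (d' : measure_display) (T : measurableType d')
    (f : T -> bool) :
  measurable_fun [set: T] f -> measurable_fun [set: T] (fun x => (f x)%:R : R).
Proof.
move=> mf; rewrite (_ : (fun x => _) = fun x => if f x then 1 else 0).
  exact: measurable_fun_ifT.
by apply/funext => x; case: (f x).
Qed.

Lemma measurable_sum_cond (d' : measure_display) (T : measurableType d')
    (I : Type) (s : seq I) (Q : pred I) (h : I -> T -> R) :
  (forall i, measurable_fun [set: T] (h i)) ->
  measurable_fun [set: T] (fun x => \sum_(i <- s | Q i) h i x).
Proof.
by move=> mh; under eq_fun do rewrite -big_filter; exact: measurable_sum.
Qed.

Variables (n m : nat).

Lemma measurable_swap_prob (s : 'S_(n + m)) (a c : 'I_(n + m)) :
  measurable_fun [set: (n + m).-tuple X] (fun z => swap_prob r z s a c).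
Proof.
have mr l : measurable_fun [set: (n + m).-tuple X] (fun z => r (tnth z l)).
  by apply: (measurableT_comp r_meas); exact: measurable_tnth.
apply: measurable_funM => //; apply: measurable_funV_gt0.
  exact: measurable_funD.
by move=> z; rewrite addr_gt0.
Qed.

Lemma measurable_sampler_step (s u : 'S_(n + m)) :
  measurable_fun [set: (n + m).-tuple X] (fun z => sampler_step r z s u).
Proof.
do 2 apply: measurable_sum_cond => ?; apply: measurable_sum_cond => b.
apply: measurable_funM => //; apply: measurable_prod => k _.
rewrite /bernoulli_weight; case: (b k); first exact: measurable_swap_prob.
by apply: measurable_funB => //; exact: measurable_swap_prob.
Qed.

Lemma measurable_sampler t (s u : 'S_(n + m)) :
  measurable_fun [set: (n + m).-tuple X] (fun z => sampler r t z s u).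
Proof.
elim: t u => [|t IH] u //=.
apply: measurable_sum => v; apply: measurable_funM => //.
exact: measurable_sampler_step.
Qed.

Lemma measurable_drpt_law (S H : nat) (s : 'S_(n + m)) u :
  measurable_fun [set: (n + m).-tuple X]
    (fun z => @drpt_law R X r n m S H s z u).
Proof.
apply: measurable_funM; first exact: measurable_sampler.
by apply: measurable_prod => h _; exact: measurable_sampler.
Qed.

Lemma measurable_tail_prod :
  measurable_fun [set: (n + m).-tuple X] (tail_prod r (n := n) (m := m)).
Proof.
apply: measurable_prod => j _.
by apply: (measurableT_comp r_meas); exact: measurable_tnth.
Qed.

Lemma measurable_drpt_pvalue (H : nat) (T : (n + m).-tuple X -> R)
    (s : 'I_H -> 'S_(n + m)) :
  measurable_fun [set: (n + m).-tuple X] T ->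
  measurable_fun [set: (n + m).-tuple X] (fun z => drpt_pvalue T z s).
Proof.
move=> mT; apply: measurable_funM => //; apply: measurable_funD => //.
apply: measurable_sum => h; apply: measurable_natr_bool.
apply: measurable_fun_ler => //; apply: measurableT_comp => //.
exact: measurable_permuted.
Qed.

End MeasurableTuple.

(** * The pooled sample under the null hypothesis *)

Section NullDistribution.
Local Open Scope ereal_scope.
Context (R : realType) (dX dO : measure_display).
Context (X : measurableType dX) (Omega : measurableType dO).
Variables (mu : {measure set X -> \bar R}) (P : probability Omega R).
Variables (f g r : X -> R).
Hypotheses (f_density : is_density mu f) (g_density : is_density mu g).
Hypotheses (r_meas : measurable_fun [set: X] r) (r_gt0 : forall x, (0 < r x)%R).
Let c : R := fine (\int[mu]_y (r y * f y)%:E).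
Hypothesis H0 : \forall x \ae mu, g x = (r x * f x / c)%R.

Let c_ge0 : (0 <= c)%R.
Proof.
apply: fine_ge0; apply: integral_ge0 => x _; rewrite lee_fin.
by have [_ f0 _] := f_density; rewrite mulr_ge0// ltW.
Qed.

Lemma expectation_indic_density (V : Omega -> X) (B : set X) :
  has_density P mu V f -> measurable B ->
  \int[P]_w (\1_B (V w))%:E = \int[mu]_(x in B) (f x)%:E.
Proof.
move=> [mV VE] mB; rewrite -VE// -[X in P X]setIT -integral_indic//.
by rewrite -[X in measurable X]setTI; exact: mV.
Qed.

(** Since [g / r] equals [f / c] almost everywhere, weighting by [1 / r] gives a variable of the
    second sample the law [f] up to the factor [c^-1]. *)
Lemma expectation_indic_over_r (V : Omega -> X) (B : set X) :
  has_density P mu V g -> measurable B ->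
  \int[P]_w (\1_B (V w) / r (V w))%:E =
  (c^-1)%:E * \int[mu]_(x in B) (f x)%:E.
Proof.
move=> [mV VE] mB.
have [mf f0 _] := f_density; have [mg g0 _] := g_density.
have mrV : measurable_fun [set: X] (fun x => (r x)^-1)%R.
  exact: measurable_funV_gt0.
have mh : measurable_fun [set: X] (fun x => \1_B x / r x)%R.
  exact: measurable_funM.
have h0 x : (0 <= \1_B x / r x)%R by rewrite divr_ge0 ?indicE// ltW.
have id_meas : measurable_fun [set: X] (@id X) by exact: measurable_id.
transitivity (\int[P]_w (\1_B (V w) / r (V w) * cst 1 w)%:E).
  by apply: eq_integral => w _; rewrite /cst mulr1.
rewrite (integral_transport mV id_meas _ mg _ g0 _ mh h0 (m2 := mu))//.
  under eq_integral do rewrite /=.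
  rewrite [X in _ * X]integral_mkcond -ge0_integralZl//; first last.
  - by rewrite lee_fin invr_ge0.
  - by move=> x _; rewrite epatch_indic mule_ge0// lee_fin.
  - apply/(measurable_restrictT _ _).1 => //.
    by apply/measurable_EFinP; exact: measurable_funTS.
  apply: ge0_ae_eq_integral => //.
  - by apply/measurable_EFinP; exact: measurable_funM.
  - apply: measurable_funeM; apply/(measurable_restrictT _ _).1 => //.
    by apply/measurable_EFinP; exact: measurable_funTS.
  - by move=> x _; rewrite lee_fin mulr_ge0.
  - move=> x _; rewrite epatch_indic /= -!EFinM lee_fin.
    by rewrite !mulr_ge0 ?invr_ge0.
  apply: filterS H0 => x gx _; rewrite epatch_indic /= -!EFinM gx; congr _%:E.
  have rx : (r x != 0)%R by rewrite gt_eqF.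
  by rewrite -[(r x * f x / c)%R]mulrA mulrA mulfVK// mulrCA [RHS]mulrC mulrA.
move=> B' mB'; rewrite (integral_cst P _ 1)//.
  by rewrite mul1e; exact: VE.
by rewrite -[X in measurable X]setTI; exact: mV.
Qed.

Lemma density_integral_lty (B : set X) : measurable B ->
  \int[mu]_(x in B) (f x)%:E < +oo.
Proof.
have [mf f0 f1] := f_density => mB.
apply: (@le_lt_trans _ _ (\int[mu]_x (f x)%:E)); last by rewrite f1 ltry.
apply: ge0_subset_integral => //; first exact/measurable_EFinP.
by move=> x _; rewrite lee_fin.
Qed.

Variables (n m : nat) (Xs : 'I_n -> Omega -> X) (Ys : 'I_m -> Omega -> X).
Hypothesis Xs_law : forall i, has_density P mu (Xs i) f.
Hypothesis Ys_law : forall j, has_density P mu (Ys j) g.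
Hypothesis Z_indep : mutually_independent P
  (fun (l : 'I_(n + m)) w => tnth (pooled Xs Ys w) l).

Let Z := pooled Xs Ys.

Let mXs i : measurable_fun [set: Omega] (Xs i).
Proof. by have [] := Xs_law i. Qed.

Let mYs j : measurable_fun [set: Omega] (Ys j).
Proof. by have [] := Ys_law j. Qed.

Let mZ : measurable_fun [set: Omega] Z.
Proof. exact: measurable_pooled. Qed.

Let Z_l (i : 'I_n) w : tnth (Z w) (lshift m i) = Xs i w.
Proof. by rewrite /Z tnth_lshift tnth_mktuple. Qed.

Let Z_r (j : 'I_m) w : tnth (Z w) (rshift n j) = Ys j w.
Proof. by rewrite /Z tnth_rshift tnth_mktuple. Qed.

Let invrho w : R := (tail_prod r (Z w))^-1%R.

(** After division by [rho], coordinate [l] has law [f] times this constant. *)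
Let kappa (l : 'I_(n + m)) : \bar R :=
  if fintype.split l is inl _ then 1 else (c^-1)%:E.

(** The point is that the right side does not involve [s]: once [rho] is divided out, all
    coordinates follow [f] up to constants, so it is irrelevant which side of the box constrains
    which coordinate. *)
Let integral_box (s : 'S_(n + m)) (A : 'I_(n + m) -> set X) :
  (forall l, measurable (A l)) ->
  \int[P]_(w in [set w | forall l, A l (tnth (permuted (Z w) s) l)])
    (invrho w)%:E =
  \prod_l kappa l * \prod_l \int[mu]_(x in A l) (f x)%:E.
Proof.
move=> mA.
(* Coordinate [l] of [Z] sits at position [s^-1 l] of the permuted tuple; the second factor is its
   share of [1 / rho]. *)
pose h l x : R := (\1_(A ((s^-1)%g l)) x *
  (if fintype.split l is inl _ then 1 else (r x)^-1))%R.
have Eh l : \int[P]_w (h l (tnth (Z w) l))%:E =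
    kappa l * \int[mu]_(x in A ((s^-1)%g l)) (f x)%:E.
  rewrite /h /kappa; case: (fintype.split l) (splitK l) => [i|j] /= <-.
    rewrite mul1e -(expectation_indic_density (Xs_law i))//.
    by apply: eq_integral => w _; rewrite Z_l mulr1.
  rewrite -(expectation_indic_over_r (Ys_law j))//.
  by apply: eq_integral => w _; rewrite Z_r.
transitivity (\int[P]_w (\prod_l h l (tnth (Z w) l))%:E).
  rewrite integral_mkcond; apply: eq_integral => w _.
  rewrite epatch_indic -EFinM big_split/= mulrC; congr (_ * _)%:E.
    rewrite indicE.
    have [Aw|Aw] := pselect (forall l, A l (tnth (permuted (Z w) s) l)).
      rewrite mem_set// big1// => l _; rewrite indicE mem_set//.
      by have := Aw ((s^-1)%g l); rewrite tnth_mktuple permKV.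
    rewrite memNset//; have /existsNP[l Al] := Aw.
    rewrite (bigD1 (s l))//= indicE memNset ?mul0r// permK.
    by rewrite tnth_mktuple in Al.
  rewrite big_split_ord/= big1 ?mul1r; last first.
    by move=> i _; rewrite (unsplitK (inl i)).
  rewrite /invrho /tail_prod -prodfV; apply: eq_bigr => j _.
  by rewrite (unsplitK (inr j)).
rewrite (expectation_prod (P := P) (V := fun l w => tnth (Z w) l))//.
- under eq_bigr do rewrite Eh.
  rewrite big_split/=; congr (_ * _).
  by rewrite [RHS](reindex_inj (@perm_inj _ (s^-1)%g)).
- by move=> l; exact: (measurableT_comp (measurable_tnth l)).
- move=> l; apply: measurable_funM => //.
  by case: (fintype.split l) => // _; exact: measurable_funV_gt0.
- move=> l x; rewrite mulr_ge0 ?indicE//.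
  by case: (fintype.split l) => // _; rewrite invr_ge0 ltW.
- move=> l; rewrite Eh.
  have kfin : kappa l \is a fin_num by rewrite /kappa; case: (fintype.split l).
  by rewrite lte_mul_pinfty ?density_integral_lty// /kappa;
    case: (fintype.split l) => // _; rewrite lee_fin invr_ge0.
Qed.

Lemma weighted_exchangeable (s : 'S_(n + m)) (Psi : (n + m).-tuple X -> R) :
  measurable_fun [set: (n + m).-tuple X] Psi -> (forall z, 0 <= Psi z)%R ->
  \int[P]_w (Psi (Z w) / tail_prod r (Z w))%:E =
  \int[P]_w (Psi (permuted (Z w) s) / tail_prod r (Z w))%:E.
Proof.
move=> mPsi Psi0.
have rho_gt0 z : (0 < tail_prod r z :> R)%R by exact: tail_prod_gt0.
have minvrho : measurable_fun [set: Omega] invrho.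
  apply: measurable_funV_gt0 => //.
  by apply: measurableT_comp => //; exact: measurable_tail_prod.
have invrho_ge0 w : (0 <= invrho w)%R by rewrite invr_ge0 ltW.
have mZs : measurable_fun [set: Omega] (fun w => permuted (Z w) s).
  by apply: (measurableT_comp (measurable_permuted s)).
have p1 w : permuted (Z w) 1 = Z w.
  by apply: eq_from_tnth => l; rewrite tnth_mktuple perm1.
apply: (tuple_integral_transport mZ mZs minvrho minvrho) => //.
  move=> A mA; rewrite integral_box// -(integral_box 1)//.
  by under [X in _ = integral _ X _]eq_set do rewrite p1.
(* The total mass is that of the box with all sides [setT], a product of finite constants. *)
have := integral_box 1 (fun=> measurableT).
rewrite (_ : [set w | _] = setT); last by apply/seteqP; split.
move=> ->; rewrite ltey_eq fin_numM//; apply: prode_fin_num => l _.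
  by rewrite /kappa; case: (fintype.split l).
by have [_ _ ->] := f_density.
Qed.

End NullDistribution.

(** * From conditional mass functions to the rejection probability *)

(** The event is cut according to the value of [W]; each piece has the probability given by [q], and
    finite subadditivity suffices. *)
Lemma conditional_pmf_le (R : realType) (d dO : measure_display)
    (Y : measurableType d) (Omega : measurableType dO) (P : probability Omega R)
    (F : finType) (Z : Omega -> Y) (W : Omega -> F) (q : Y -> F -> R)
    (b : F -> Y -> bool) :
  measurable_fun [set: Omega] Z ->
  (forall u, measurable_fun [set: Y] (q^~ u)) -> (forall z u, 0 <= q z u) ->
  (forall u, measurable_fun [set: Y] (b u)) ->
  has_conditional_pmf P Z W q ->
  (P [set w | b (W w) (Z w)] <=
   \int[P]_w (\sum_u q (Z w) u * (b u (Z w))%:R)%:E)%E.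
Proof.
move=> mZ mq q0 mb [mW qE].
pose A u := [set z | b u z].
have mA u : measurable (A u).
  by rewrite -[A u]setTI -[A u]/(b u @^-1` [set true]); exact: mb.
have mZA u : measurable (Z @^-1` A u).
  by rewrite -[X in measurable X]setTI; exact: mZ.
have mqb u : measurable_fun [set: Omega] (fun w => q (Z w) u * (b u (Z w))%:R).
  apply: measurable_funM; first exact: (measurableT_comp (mq u)).
  by apply: measurable_natr_bool; exact: (measurableT_comp (mb u)).
have qb0 u w : 0 <= q (Z w) u * (b u (Z w))%:R by rewrite mulr_ge0.
under eq_integral do rewrite -sumEFin.
rewrite ge0_integral_sum//; first last.
- by move=> u w _; rewrite lee_fin.
- by move=> u; exact/measurable_EFinP.
pose E u := Z @^-1` A u `&` W @^-1` [set u].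
rewrite (_ : [set w | _] = \big[setU/set0]_u E u); last first.
  rewrite -bigcup_seq; apply/seteqP; split => [w /= bw|w [u _ [/= bu ->]]//].
  by exists (W w) => //=; rewrite mem_index_enum.
have qbE u : (\int[P]_w (q (Z w) u * (b u (Z w))%:R)%:E)%E = P (E u).
  rewrite qE// [RHS]integral_mkcond; apply: eq_integral => w _.
  rewrite epatch_indic /= -EFinM; congr (_ * _)%:E.
  rewrite indicE; suff -> : (w \in Z @^-1` A u) = b u (Z w) by [].
  by apply/idP/idP; rewrite inE.
rewrite [leRHS](eq_bigr _ (fun u _ => qbE u)).
have : measurable (\big[setU/set0]_u E u) /\
   (P (\big[setU/set0]_u E u) <= \sum_u P (E u))%E.
  elim/big_rec2: _ => [|u x B _ [mB Bx]]; first by rewrite measure0.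
  have mE : measurable (E u) by exact: measurableI.
  split; first exact: measurableU.
  by apply: le_trans (measureU2 _ _ _) _ => //; rewrite leeD2l.
by case.
Qed.

Theorem theorem3
  (R : realType)
  (dX : measure_display) (X : measurableType dX)
  (mu : {measure set X -> \bar R})
  (f g r : X -> R)
  (f_density : is_density mu f) (g_density : is_density mu g)
  (r_meas : measurable_fun [set: X] r) (r_gt0 : forall x, 0 < r x)
  (fg_support : same_support mu f g)
  (g_over_r : (\int[mu]_x (g x / r x)%:E < +oo)%E)
  (rf_int : (\int[mu]_x (r x * f x)%:E < +oo)%E)
  (n m : nat) (n_ge1 : (1 <= n)%N) (m_ge1 : (1 <= m)%N)
  (dO : measure_display) (Omega : measurableType dO) (P : probability Omega R)
  (Xs : 'I_n -> Omega -> X) (Ys : 'I_m -> Omega -> X)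
  (Xs_law : forall i, has_density P mu (Xs i) f)
  (Ys_law : forall j, has_density P mu (Ys j) g)
  (Z_indep : mutually_independent P
     (fun (l : 'I_(n + m)) w => tnth (pooled Xs Ys w) l))
  (S H : nat) (S_ge1 : (1 <= S)%N) (H_ge1 : (1 <= H)%N)
  (T : (n + m).-tuple X -> R)
  (T_meas : measurable_fun [set: (n + m).-tuple X] T)
  (sigma_star : Omega -> 'S_(n + m)) (sigma : 'I_H -> Omega -> 'S_(n + m))
  (sigma_law : has_conditional_pmf P (pooled Xs Ys)
     (fun w => (sigma_star w, [ffun h => sigma h w]))
     (@drpt_law R X r n m S H 1%g))
  (H0 : \forall x \ae mu,
     g x = r x * f x / fine (\int[mu]_y (r y * f y)%:E)%E) :
  forall alpha : R, 0 <= alpha <= 1 ->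
    (P [set w | (drpt_pvalue T (pooled Xs Ys w) (fun h => sigma h w)
                 <= alpha)%R] <= alpha%:E)%E.
Proof.
move=> alpha /andP[alpha0 _].
pose Z := pooled Xs Ys.
have mZ : measurable_fun [set: Omega] Z.
  apply: measurable_pooled => [i|j]; first by have [] := Xs_law i.
  by have [] := Ys_law j.
pose law z u := @drpt_law R X r n m S H 1%g z u.
have law0 z u : 0 <= law z u.
  by rewrite mulr_ge0 ?prodr_ge0// => *; exact: sampler_ge0.
have mlaw u : measurable_fun [set: (n + m).-tuple X] (law^~ u).
  exact: measurable_drpt_law.
pose b (u : 'S_(n + m) * {ffun 'I_H -> 'S_(n + m)}) z :=
  drpt_pvalue T z u.2 <= alpha.
have mb u : measurable_fun [set: (n + m).-tuple X] (b u).
  by apply: measurable_fun_ler => //; exact: measurable_drpt_pvalue.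
(* [Phi z] is the conditional probability of rejection given [Z = z]. *)
pose Phi z := \sum_u law z u * (b u z)%:R.
have mPhi : measurable_fun [set: (n + m).-tuple X] Phi.
  apply: measurable_sum => u; apply: measurable_funM => //.
  exact: measurable_natr_bool.
have Phi0 z : 0 <= Phi z by apply: sumr_ge0 => u _; rewrite mulr_ge0.
apply: (@le_trans _ _ (\int[P]_w (Phi (Z w))%:E)%E).
  apply: le_trans (conditional_pmf_le mZ mlaw law0 mb sigma_law).
  rewrite le_eqVlt; apply/orP; left; apply/eqP; congr (P _).
  apply/funext => w; rewrite /b /=; congr (is_true (_ * (_ + _) <= _)).
  by apply: eq_bigr => h _; rewrite ffunE.
pose rho := tail_prod r (n := n) (m := m).
have rho_gt0 z : 0 < rho z by exact: tail_prod_gt0.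
have mrho : measurable_fun [set: (n + m).-tuple X] rho.
  exact: measurable_tail_prod.
(* Exchangeability is applied to [rho * Psi], so that the division by [rho] cancels on the
   unpermuted side. *)
have exch (Psi : (n + m).-tuple X -> R) s :
    measurable_fun [set: (n + m).-tuple X] Psi -> (forall z, 0 <= Psi z) ->
    (\int[P]_w (Psi (Z w))%:E =
     \int[P]_w (rho (permuted (Z w) s) * Psi (permuted (Z w) s) /
       rho (Z w))%:E)%E.
  move=> mPsi Psi0.
  transitivity (\int[P]_w (rho (Z w) * Psi (Z w) / rho (Z w))%:E)%E.
    by apply: eq_integral => w _; rewrite mulrAC mulfV ?mul1r// gt_eqF.
  apply: (weighted_exchangeable f_density g_density r_meas r_gt0 H0 Xs_law
    Ys_law Z_indep s (Psi := fun z => rho z * Psi z)).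
    exact: measurable_funM.
  by move=> z; rewrite mulr_ge0// ltW.
pose N := #|'S_(n + m)|.
have N_gt0 : 0 < N%:R :> R by rewrite ltr0n; apply/card_gt0P; exists 1%g.
have mV : measurable_fun [set: Omega] (fun w => (rho (Z w))^-1).
  by apply: measurable_funV_gt0 => //; exact: measurableT_comp.
have morb (Psi : (n + m).-tuple X -> R) s :
    measurable_fun [set: (n + m).-tuple X] Psi ->
    measurable_fun [set: Omega]
      (fun w => rho (permuted (Z w) s) * Psi (permuted (Z w) s)).
  move=> mPsi.
  have mZs : measurable_fun [set: Omega] (fun w => permuted (Z w) s).
    exact: (measurableT_comp (measurable_permuted s)).
  by apply: measurable_funM; exact: (measurableT_comp _ mZs).
have orbit_sum (Psi : (n + m).-tuple X -> R) :
    measurable_fun [set: (n + m).-tuple X] Psi -> (forall z, 0 <= Psi z) ->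
    (N%:R%:E * \int[P]_w (Psi (Z w))%:E = \int[P]_w
      ((\sum_s rho (permuted (Z w) s) * Psi (permuted (Z w) s)) /
       rho (Z w))%:E)%E.
  move=> mPsi Psi0.
  under [RHS]eq_integral do rewrite mulr_suml -sumEFin.
  rewrite ge0_integral_sum//; first last.
  - by move=> s w _; rewrite lee_fin divr_ge0 ?mulr_ge0// ltW.
  - move=> s; apply/measurable_EFinP; apply: measurable_funM => //.
    exact: morb.
  rewrite (eq_bigr (fun=> \int[P]_w (Psi (Z w))%:E))%E; last first.
    by move=> s _; rewrite -exch.
  rewrite (_ : N%:R%:E = \sum_(s : 'S_(n + m)) 1)%E.
    by rewrite ge0_sume_distrl//; apply: eq_bigr => s _; rewrite mul1e.
  by rewrite sumEFin sumr_const.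
(* Multiplying by the number of permutations turns the expectation of [Phi] into that of an orbit
   sum, to which the bound on one orbit applies pointwise. *)
rewrite -(@lee_pmul2l _ N%:R%:E)// ?lte_fin// orbit_sum//.
pose orb (Psi : (n + m).-tuple X -> R) w :=
  (\sum_s rho (permuted (Z w) s) * Psi (permuted (Z w) s)) / rho (Z w).
have mo (Psi : (n + m).-tuple X -> R) :
    measurable_fun [set: (n + m).-tuple X] Psi ->
    measurable_fun [set: Omega] (fun w => (orb Psi w)%:E).
  move=> mPsi; apply/measurable_EFinP; apply: measurable_funM => //.
  by apply: measurable_sum => s; exact: morb.
have orb0 (Psi : (n + m).-tuple X -> R) w :
    (forall z, 0 <= Psi z) -> 0 <= orb Psi w.
  move=> Psi0; apply: divr_ge0; last exact: ltW.
  by apply: sumr_ge0 => s _; rewrite mulr_ge0// ltW.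
have orb1 w : (0 <= (orb (cst 1) w)%:E)%E.
  by rewrite lee_fin orb0// => z; exact: ler01.
apply: (@le_trans _ _ (\int[P]_w (alpha%:E * (orb (cst 1) w)%:E))%E).
  apply: ge0_le_integral => //.
  - by move=> w _; rewrite lee_fin orb0.
  - exact: mo.
  - by apply: measurable_funeM; exact: mo.
  move=> w _; rewrite -EFinM lee_fin /orb mulrA ler_wpM2r//.
    by rewrite invr_ge0 ltW.
  rewrite (eq_bigr _ (fun s _ => mulr1 (rho (permuted (Z w) s)))).
  exact: (drpt_orbit_bound r_gt0 S H T (Z w) alpha0).
rewrite ge0_integralZl//; last exact: mo.
(* Read backwards for the constant 1, the same identity evaluates the remaining integral as [N]. *)
rewrite -(orbit_sum (cst 1))//.
have -> : (\int[P]_w (cst 1 (Z w))%:E = 1)%E.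
  by rewrite (integral_cst P _ 1)// mul1e; exact: probability_setT.
by rewrite mule1 muleC.
Qed.
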